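(* For every code $\nu:\mathrm E$, (1) the topped ordinal $\mathrm K\nu$ has infima of complemented subsets, hence is compact; (2) the embedding $\iota_\nu:\Delta\nu\to\mathrm K\nu$ (of underlying types) is extremely dense, order-preserving and order-reflecting.
   Context: Foundation: intensional Martin-Löf type theory as in the HoTT Book, with $\mathbf 0$, $\mathbf 1$ (point $\star$), $\mathbf 2$ (points $0,1$), $\mathbb N$, $+$, $\Pi$, $\Sigma$, universes, univalence (hence function extensionality), propositional truncation, set quotients, and inductive-recursive definitions. No excluded middle is assumed. $f^{-1}(y):=\Sigma_x(f\,x=y)$; an embedding is a map all of whose fibers are propositions (types with at most one element). $f:X\to Y$ is extremely dense if $\neg\,\Sigma_{y:Y}\,\neg\,\Sigma_{x:X}\,f\,x=y$; order-preserving if $x<x'\to f\,x<f\,x'$; order-reflecting if $f\,x<f\,x'\to x<x'$. A type $X$ is compact if for every $p:X\to\mathbf 2$ the type $\Sigma_{x:X}\,p\,x=0$ is decidable. A type $X$ with a relation $\le$ has infima of complemented subsets if for every $p:X\to\mathbf 2$ there is $x_0:X$ such that (a) if $p$ has a root (a point with $p\,x=0$) then $x_0$ is a root, and (b) $x_0\le x$ for every root $x$, and $l\le x_0$ for every $l$ that is $\le$ all roots. For a topped ordinal this is with respect to $x\le y:\equiv\neg(y<x)$. Ordinals. An ordinal is a type with a proposition-valued, transitive, extensional (elements with the same predecessors are equal), well-founded relation $<$; the same symbol denotes an ordinal and its underlying type. $\mathbf 1$ is an ordinal with the empty order. A topped ordinal is an ordinal with a specified point $t$ such that $\neg(t<y)$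 for all $y$; $\mathrm{Ord}^\top$ is their type. For a topped ordinal $\tau$ and $\upsilon:\tau\to\mathrm{Ord}^\top$, $\Sigma_\tau\upsilon$ is the topped ordinal $\Sigma_{x:\tau}\upsilon\,x$ with the lexicographic order: $(x,a)<(x',a')$ iff $x<x'$, or there is $r:x=x'$ such that the transport of $a$ along $r$ is below $a'$; its top is the pair of tops. The sum $\tau+\upsilon$ of topped ordinals is the lexicographic sum, over the two-point topped ordinal with underlying type $\mathbf 1+\mathbf 1$ and $\mathrm{inl}\,\star<\mathrm{inr}\,\star$, of the family with members $\tau,\upsilon$; its points are pairs $(\mathrm{inl}\,\star,x)$ or $(\mathrm{inr}\,\star,y)$. The topped ordinal $\omega+\mathbf 1$ is $\mathbb N+\mathbf 1$ with the usual order on $\mathbb N$ and the added point as top, above all $\mathrm{inl}\,n$. Conaturals: $\mathbb N_\infty:=\Sigma_{u:\mathbf 2^{\mathbb N}}\prod_i u_{i+1}\le u_i$; $\underline n$ is $n$ ones followed by zeros; $\infty$ is constantly $1$. It is a topped ordinal with top $\infty$ under $u<v:\equiv\Sigma_{n:\mathbb N}(u=\underline n)\times(v_n=1)$. $\iota_1:\mathbb N+\mathbf 1\hookrightarrow\mathbb N_\infty$ sends $\mathrm{inl}\,n$ to $\underline n$ and the added point to $\infty$. Extension: for an embedding $j:X\hookrightarrow K$ and $\alpha:X\to\mathrm{Ord}^\top$, $(\alpha/j)\,k:=\prod_{(x,p):j^{-1}(k)}\alpha\,x$ with order $u<v:\equiv\Sigma_{p:j^{-1}(k)}\,u\,p<v\,p$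 and top the function assigning tops. Evaluation at $(x,\mathrm{refl})$ is an order equivalence $(\alpha/j)(j\,x)\simeq\alpha\,x$. Codes. $\mathrm E$ and $\Delta:\mathrm E\to\mathrm{Ord}^\top$ are defined simultaneously by induction-recursion. Constructors of $\mathrm E$: $\ulcorner\mathbf 1\urcorner$; $\ulcorner\omega+\mathbf 1\urcorner$; $\nu_0\,\ulcorner+\urcorner\,\nu_1$ and $\nu_0\,\ulcorner\times\urcorner\,\nu_1$ for $\nu_0,\nu_1:\mathrm E$; $\ulcorner\Sigma\urcorner\,\nu\,A$ for $\nu:\mathrm E$ and $A:\Delta\nu\to\mathrm E$. $\Delta\ulcorner\mathbf 1\urcorner=\mathbf 1$; $\Delta\ulcorner\omega+\mathbf 1\urcorner=\omega+\mathbf 1$; $\Delta(\nu_0\,\ulcorner+\urcorner\,\nu_1)=\Delta\nu_0+\Delta\nu_1$; $\Delta(\nu_0\,\ulcorner\times\urcorner\,\nu_1)=\Sigma_{\Delta\nu_0}(\lambda\_.\,\Delta\nu_1)$; $\Delta(\ulcorner\Sigma\urcorner\,\nu\,A)=\Sigma_{\Delta\nu}(\Delta\circ A)$. Simultaneously by induction on codes one defines $\mathrm K:\mathrm E\to\mathrm{Ord}^\top$ and $\iota_\nu:\Delta\nu\to\mathrm K\nu$ and proves that $\iota_\nu$ is an embedding: $\mathrm K\ulcorner\mathbf 1\urcorner=\mathbf 1$; $\mathrm K\ulcorner\omega+\mathbf 1\urcorner=\mathbb N_\infty$; $\mathrm K(\nu_0\,\ulcorner+\urcorner\,\nu_1)=\mathrm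 K\nu_0+\mathrm K\nu_1$; $\mathrm K(\nu_0\,\ulcorner\times\urcorner\,\nu_1)=\Sigma_{\mathrm K\nu_0}(\lambda\_.\,\mathrm K\nu_1)$; $\mathrm K(\ulcorner\Sigma\urcorner\,\nu\,A)=\Sigma_{\mathrm K\nu}\big((\mathrm K\circ A)/\iota_\nu\big)$; and $\iota_{\ulcorner\mathbf 1\urcorner}=\mathrm{id}$; $\iota_{\ulcorner\omega+\mathbf 1\urcorner}=\iota_1$; $\iota_{\nu_0\ulcorner+\urcorner\nu_1}(\mathrm{inl}\,\star,y)=(\mathrm{inl}\,\star,\iota_{\nu_0}y)$, $\iota_{\nu_0\ulcorner+\urcorner\nu_1}(\mathrm{inr}\,\star,y)=(\mathrm{inr}\,\star,\iota_{\nu_1}y)$; $\iota_{\nu_0\ulcorner\times\urcorner\nu_1}(x,y)=(\iota_{\nu_0}x,\iota_{\nu_1}y)$; $\iota_{\ulcorner\Sigma\urcorner\nu A}(x,z)=(\iota_\nu x,\varphi_x^{-1}(\iota_{A\,x}z))$, where $\varphi_x:((\mathrm K\circ A)/\iota_\nu)(\iota_\nu x)\simeq\mathrm K(A\,x)$ is evaluation at $(x,\mathrm{refl})$. *)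

(* Defs.v *)
From Stdlib Require Import FunctionalExtensionality Bool Arith.
Import EqNotations.

(** Conventions.  Identity types are Rocq's [eq]: it eliminates into [Type] and
    no proof irrelevance, UIP or excluded middle is used, so it plays the role
    of the identity type of Martin-Löf type theory.  The only axiom below is
    function extensionality.  Order relations are [Type]-valued, existence is
    [sigT], disjunction is [sum], negation is [notT].  The type with two points
    is [bool], with [false] for 0 and [true] for 1. *)

Definition is_prop (X : Type) : Type := forall x y : X, x = y.

Definition is_set (X : Type) : Type := forall x y : X, is_prop (x = y).

Definition fiber {X Y : Type} (f : X -> Y) (y : Y) : Type := {x : X & f x = y}.

Definition is_embedding {X Y : Type} (f : X -> Y) : Type :=
  forall y : Y, is_prop (fiber f y).

Definition decidable (X : Type) : Type := (X + notT X)%type.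

Definition extremely_dense {X Y : Type} (f : X -> Y) : Type :=
  notT {y : Y & notT {x : X & f x = y}}.

Definition root {X : Type} (p : X -> bool) (x : X) : Type := p x = false.

Definition compact (X : Type) : Type :=
  forall p : X -> bool, decidable {x : X & root p x}.

Definition has_infima_of_complemented_subsets
    (X : Type) (le : X -> X -> Type) : Type :=
  forall p : X -> bool,
    {x0 : X &
      (({x : X & root p x} -> root p x0) *
       ((forall x : X, root p x -> le x0 x) *
        (forall l : X, (forall x : X, root p x -> le l x) -> le l x0)))%type}.

(** ** Truth values and sets *)

Lemma is_prop_pi {X : Type} {P : X -> Type} :
  (forall x, is_prop (P x)) -> is_prop (forall x, P x).
Proof.
intros H f g; apply functional_extensionality_dep; intro x; apply H.
Qed.

Lemma is_prop_sigT {X : Type} {P : X -> Type} :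
  is_prop X -> (forall x, is_prop (P x)) -> is_prop {x : X & P x}.
Proof.
intros HX HP [x a] [y b]; destruct (HX x y); f_equal; apply HP.
Qed.

Lemma is_prop_arrow {X Y : Type} : is_prop Y -> is_prop (X -> Y).
Proof. intro H; apply is_prop_pi; intros _; exact H. Qed.

Lemma set_from_const_endo {X : Type} (f : forall x y : X, x = y -> x = y) :
  (forall x y (p q : x = y), f x y p = f x y q) -> is_set X.
Proof.
intros Hf.
assert (E : forall x y (p : x = y), p = eq_trans (eq_sym (f x x eq_refl)) (f x y p)).
{ intros x y p; destruct p; destruct (f x x eq_refl); reflexivity. }
intros x y p q; rewrite (E x y p), (E x y q), (Hf x y p q); reflexivity.
Qed.

Lemma prop_is_set {X : Type} : is_prop X -> is_set X.
Proof.
intro H; apply (set_from_const_endo (fun x y _ => H x y)); reflexivity.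
Qed.

Lemma bool_is_set : is_set bool.
Proof. intros x y p q; apply (Eqdep_dec.UIP_dec bool_dec). Qed.

Lemma injective_is_embedding {X Y : Type} (f : X -> Y) :
  is_set Y -> (forall x x', f x = f x' -> x = x') -> is_embedding f.
Proof.
intros HY Hf y [x p] [x' q].
assert (e : x = x') by (apply Hf; exact (eq_trans p (eq_sym q))).
destruct e; f_equal; apply HY.
Qed.

Lemma embedding_injective {X Y : Type} (f : X -> Y) :
  is_embedding f -> forall x x', f x = f x' -> x = x'.
Proof.
intros Hf x x' e.
exact (f_equal (@projT1 _ _)
  (Hf (f x') (existT _ x e) (existT (fun z => f z = f x') x' eq_refl))).
Qed.

Lemma sigT_snd_inj {X : Type} (P : X -> Type) (x : X) (a b : P x) :
  is_set X -> existT P x a = existT P x b -> a = b.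
Proof.
intros HX h; pose proof (projT2_eq h) as r.
rewrite (HX x x (projT1_eq h) eq_refl) in r; exact r.
Qed.

(** ** Ordinals *)

(** The standard library's [Acc] requires a [Prop]-valued relation. *)
Inductive acc {X : Type} (olt : X -> X -> Type) (x : X) : Type :=
| acc_intro : (forall y, olt y x -> acc olt y) -> acc olt x.

Definition acc_inv {X : Type} {olt : X -> X -> Type} {x : X} (h : acc olt x) :
  forall y, olt y x -> acc olt y := match h with acc_intro _ _ g => g end.

Record Ord : Type := MkOrd {
  carrier :> Type;
  olt : carrier -> carrier -> Type;
  olt_prop : forall x y, is_prop (olt x y);
  olt_trans : forall x y z, olt x y -> olt y z -> olt x z;
  olt_ext : forall x y,
    (forall z, olt z x -> olt z y) -> (forall z, olt z y -> olt z x) -> x = y;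
  olt_wf : forall x, acc olt x
}.

Arguments olt {o}.
Arguments olt_prop {o}.
Arguments olt_trans {o}.
Arguments olt_ext {o}.
Arguments olt_wf {o}.

Record OrdT : Type := MkOrdT {
  ord_of :> Ord;
  top : ord_of;
  top_max : forall y : ord_of, notT (olt top y)
}.

Arguments top {o}.
Arguments top_max {o}.

Definition ole {X : Ord} (x y : X) : Type := notT (olt y x).

Definition order_preserving {X Y : Ord} (f : X -> Y) : Type :=
  forall x x' : X, olt x x' -> olt (f x) (f x').

Definition order_reflecting {X Y : Ord} (f : X -> Y) : Type :=
  forall x x' : X, olt (f x) (f x') -> olt x x'.

Lemma olt_irrefl {X : Ord} (x : X) : notT (olt x x).
Proof.
induction (olt_wf x) as [x _ IH]; intro h; exact (IH x h h).
Qed.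

Lemma ord_is_set (X : Ord) : is_set X.
Proof.
apply (set_from_const_endo (fun x y (p : x = y) =>
  olt_ext x y (fun z h => rew [fun w => olt z w] p in h)
             (fun z h => rew <- [fun w => olt z w] p in h))).
intros x y p q; f_equal;
  apply is_prop_pi; intro z; apply is_prop_arrow, olt_prop.
Qed.

(** *** The one-point ordinal *)

Definition oneO : Ord.
Proof.
refine (MkOrd unit (fun _ _ => Empty_set) _ _ _ _).
- intros _ _ [].
- intros _ _ _ [].
- intros [] [] _ _; reflexivity.
- intros x; constructor; intros _ [].
Defined.

Definition oneT : OrdT := MkOrdT oneO tt (fun y h => match h with end).

(** *** The two-point ordinal *)

Definition two_lt (x y : unit + unit) : Type :=
  match x, y with inl _, inr _ => unit | _, _ => Empty_set end.

Definition twoO : Ord.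
Proof.
refine (MkOrd (unit + unit) two_lt _ _ _ _).
- intros [x|x] [y|y]; intros p q; destruct p, q; reflexivity.
- intros [x|x] [y|y] [z|z]; simpl; tauto.
- intros [[]|[]] [[]|[]] f g; try reflexivity.
  + destruct (g (inl tt) tt).
  + destruct (f (inl tt) tt).
- assert (H : forall x, acc two_lt (inl x)).
  { intro x; constructor; intros [y|y] []. }
  intros [x|x]; [apply H|constructor].
  intros [y|y] h; [apply H|destruct h].
Defined.

Definition twoT : OrdT.
Proof.
refine (MkOrdT twoO (inr tt) _); intros [y|y] [].
Defined.

(** *** The ordinal omega + 1 *)

Definition omega1_lt (x y : nat + unit) : Type :=
  match x, y with
  | inl m, inl n => (m < n)%nat
  | inl _, inr _ => unit
  | inr _, _ => Empty_set
  end.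

Lemma omega1_acc (n : nat) : forall m, (m < n)%nat -> acc omega1_lt (inl m).
Proof.
induction n as [|n IH]; intros m h.
- exfalso; exact (Nat.nlt_0_r m h).
- constructor; intros [k|k] hk; [apply IH|destruct hk].
  exact (Nat.lt_le_trans k m n hk (proj1 (Nat.lt_succ_r m n) h)).
Qed.

Definition omega1O : Ord.
Proof.
refine (MkOrd (nat + unit) omega1_lt _ _ _ _).
- intros [m|x] [n|y]; simpl; intros p q.
  + apply le_unique.
  + destruct p, q; reflexivity.
  + destruct p.
  + destruct p.
- intros [m|x] [n|y] [k|z]; simpl; try tauto.
  exact (Nat.lt_trans m n k).
- intros [m|[]] [n|[]] f g; try reflexivity.
  + f_equal; destruct (lt_eq_lt_dec m n) as [[h|h]|h].
    * destruct (Nat.lt_irrefl m (g (inl m) h)).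
    * exact h.
    * destruct (Nat.lt_irrefl n (f (inl n) h)).
  + destruct (Nat.lt_irrefl m (g (inl m) tt)).
  + destruct (Nat.lt_irrefl n (f (inl n) tt)).
- assert (H : forall n, acc omega1_lt (inl n)).
  { intro n; exact (omega1_acc (S n) n (Nat.lt_succ_diag_r n)). }
  intros [n|x]; [apply H|constructor].
  intros [m|y] h; [apply H|destruct h].
Defined.

Definition omega1T : OrdT.
Proof.
refine (MkOrdT omega1O (inr tt) _); intros y [].
Defined.

(** *** The conatural numbers *)

(** [Bool.le b c] is the usual order on [bool]: [c = true] if [b], else [True]. *)
Definition conat : Type :=
  {u : nat -> bool & forall i : nat, Bool.le (u (S i)) (u i)}.

Definition digit (u : conat) (i : nat) : bool := projT1 u i.

Definition under (n : nat) : conat.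
Proof.
exists (fun i => Nat.ltb i n).
intro i; destruct (Nat.ltb_spec (S i) n) as [h|h]; simpl; [|exact I].
apply Nat.ltb_lt; exact (Nat.lt_trans i (S i) n (Nat.lt_succ_diag_r i) h).
Defined.

Definition infty : conat.
Proof.
exists (fun _ => true); intro i; reflexivity.
Defined.

Lemma bool_le_prop (b c : bool) : is_prop (Bool.le b c).
Proof.
destruct b; simpl; intros p q; [apply bool_is_set|destruct p, q; reflexivity].
Qed.

Lemma conat_eq (u v : conat) : (forall i, digit u i = digit v i) -> u = v.
Proof.
intro h; apply eq_sigT_hprop.
- intro w; apply is_prop_pi; intro i; apply bool_le_prop.
- apply functional_extensionality; exact h.
Qed.

Lemma conat_is_set : is_set conat.
Proof.
apply (set_from_const_endo (fun u v (p : u = v) =>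
  conat_eq u v (fun i => f_equal (fun w => digit w i) p))).
intros u v p q; f_equal; apply is_prop_pi; intro i; apply bool_is_set.
Qed.

Lemma digit_down (u : conat) (m n : nat) :
  (m <= n)%nat -> digit u n = true -> digit u m = true.
Proof.
intro h; induction h as [|n h IH]; [exact (fun e => e)|intro e; apply IH].
pose proof (projT2 u n) as d; unfold digit in *; rewrite e in d; exact d.
Qed.

Lemma digit_under (n i : nat) : digit (under n) i = Nat.ltb i n.
Proof. reflexivity. Qed.

Lemma under_inj (m n : nat) : under m = under n -> m = n.
Proof.
intro e; destruct (lt_eq_lt_dec m n) as [[h|h]|h]; [|exact h|]; exfalso.
- pose proof (f_equal (fun w => digit w m) e) as d; cbv beta in d.
  rewrite !digit_under, Nat.ltb_irrefl, (proj2 (Nat.ltb_lt m n) h) in d.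
  discriminate d.
- pose proof (f_equal (fun w => digit w n) e) as d; cbv beta in d.
  rewrite !digit_under, Nat.ltb_irrefl, (proj2 (Nat.ltb_lt n m) h) in d.
  discriminate d.
Qed.

Lemma infty_not_under (n : nat) : infty = under n -> False.
Proof.
intro e; pose proof (f_equal (fun w => digit w n) e) as d; cbv beta in d.
rewrite digit_under, Nat.ltb_irrefl in d; discriminate d.
Qed.

Definition conat_lt (u v : conat) : Type :=
  {n : nat & ((u = under n) * (digit v n = true))%type}.

Lemma conat_lt_prop (u v : conat) : is_prop (conat_lt u v).
Proof.
intros [m [p p']] [n [q q']].
assert (e : m = n) by (apply under_inj; exact (eq_trans (eq_sym p) q)).
destruct e; f_equal; f_equal; [apply conat_is_set|apply bool_is_set].
Qed.

Lemma conat_lt_trans (u v w : conat) :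
  conat_lt u v -> conat_lt v w -> conat_lt u w.
Proof.
intros [m [p p']] [n [q q']]; exists m; split; [exact p|].
rewrite q, digit_under in p'; apply Nat.ltb_lt in p'.
exact (digit_down w m n (Nat.lt_le_incl _ _ p') q').
Qed.

Lemma conat_lt_ext (u v : conat) :
  (forall w, conat_lt w u -> conat_lt w v) ->
  (forall w, conat_lt w v -> conat_lt w u) -> u = v.
Proof.
assert (H : forall u v, (forall w, conat_lt w u -> conat_lt w v) ->
              forall i, digit u i = true -> digit v i = true).
{ intros u' v' f i e.
  destruct (f (under i) (existT _ i (eq_refl, e))) as [n [p p']].
  apply under_inj in p; rewrite p; exact p'. }
intros f g; apply conat_eq; intro i.
pose proof (H u v f i) as hu; pose proof (H v u g i) as hv.
destruct (digit u i), (digit v i); try reflexivity.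
- symmetry; apply hu; reflexivity.
- apply hv; reflexivity.
Qed.

Lemma under_acc (n : nat) : forall m, (m < n)%nat -> acc conat_lt (under m).
Proof.
induction n as [|n IH]; intros m h.
- exfalso; exact (Nat.nlt_0_r m h).
- constructor; intros u [k [p q]]; rewrite p; apply IH.
  rewrite digit_under in q; apply Nat.ltb_lt in q.
  exact (Nat.lt_le_trans k m n q (proj1 (Nat.lt_succ_r m n) h)).
Qed.

Lemma conat_lt_wf (u : conat) : acc conat_lt u.
Proof.
constructor; intros v [n [p _]]; rewrite p.
exact (under_acc (S n) n (Nat.lt_succ_diag_r n)).
Qed.

Definition conatO : Ord :=
  MkOrd conat conat_lt conat_lt_prop conat_lt_trans conat_lt_ext conat_lt_wf.

Definition conatT : OrdT :=
  MkOrdT conatO infty (fun _ h => infty_not_under (projT1 h) (fst (projT2 h))).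

Definition iota1 (x : nat + unit) : conat :=
  match x with inl n => under n | inr _ => infty end.

Lemma iota1_embedding : is_embedding iota1.
Proof.
apply injective_is_embedding; [exact conat_is_set|].
intros [m|[]] [n|[]] e; simpl in e.
- f_equal; apply under_inj; exact e.
- destruct (infty_not_under m (eq_sym e)).
- destruct (infty_not_under n e).
- reflexivity.
Qed.

(** *** Lexicographic sums *)

Section Sum.

Variables (tau : OrdT) (ups : tau -> OrdT).

Definition sum_lt (s t : {x : tau & ups x}) : Type :=
  (olt (projT1 s) (projT1 t) +
   {r : projT1 s = projT1 t &
     olt (rew [fun x => carrier (ups x)] r in projT2 s) (projT2 t)})%type.

Lemma sum_lt_prop s t : is_prop (sum_lt s t).
Proof.
destruct s as [x a], t as [y b]; unfold sum_lt; simpl.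
intros [p|[r p]] [q|[r' q]].
- f_equal; apply olt_prop.
- exfalso; destruct r'; exact (olt_irrefl _ p).
- exfalso; destruct r; exact (olt_irrefl _ q).
- f_equal; apply is_prop_sigT; [apply ord_is_set|intro; apply olt_prop].
Qed.

Lemma sum_lt_trans s t u : sum_lt s t -> sum_lt t u -> sum_lt s u.
Proof.
destruct s as [x a], t as [y b], u as [z c]; unfold sum_lt; simpl.
intros [p|[r p]] [q|[r' q]].
- left; exact (olt_trans _ _ _ p q).
- left; destruct r'; exact p.
- left; destruct r; exact q.
- right; destruct r; destruct r'; exists eq_refl; exact (olt_trans _ _ _ p q).
Qed.

Lemma sum_lt_fst_incl x y (a : ups x) (b : ups y) :
  (forall u, sum_lt u (existT _ x a) -> sum_lt u (existT _ y b)) ->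
  forall z, olt z x -> olt z y.
Proof.
intros f z h.
destruct (f (existT _ z top) (inl h)) as [h'|[r h']]; simpl in *; [exact h'|].
destruct r; destruct (top_max _ h').
Qed.

Lemma sum_lt_snd_incl x (a b : ups x) :
  (forall u, sum_lt u (existT _ x a) -> sum_lt u (existT _ x b)) ->
  forall c, olt c a -> olt c b.
Proof.
intros f c h.
destruct (f (existT _ x c) (inr (existT _ eq_refl h))) as [h'|[r h']];
  simpl in *; [destruct (olt_irrefl _ h')|].
rewrite (ord_is_set tau x x r eq_refl) in h'; exact h'.
Qed.

Lemma sum_lt_ext s t :
  (forall u, sum_lt u s -> sum_lt u t) ->
  (forall u, sum_lt u t -> sum_lt u s) -> s = t.
Proof.
destruct s as [x a], t as [y b]; intros f g.
assert (e : x = y).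
{ apply olt_ext; [exact (sum_lt_fst_incl x y a b f)|exact (sum_lt_fst_incl y x b a g)]. }
destruct e; f_equal; apply olt_ext.
- exact (sum_lt_snd_incl x a b f).
- exact (sum_lt_snd_incl x b a g).
Qed.

Lemma sum_lt_wf s : acc sum_lt s.
Proof.
destruct s as [x a]; revert a.
induction (olt_wf x) as [x _ IHx]; intro a.
induction (olt_wf a) as [a _ IHa].
constructor; intros [y b] [h|[r h]]; simpl in *.
- exact (IHx y h b).
- destruct r; exact (IHa b h).
Qed.

Definition SumO : Ord :=
  MkOrd {x : tau & ups x} sum_lt sum_lt_prop sum_lt_trans sum_lt_ext sum_lt_wf.

Lemma sum_top_max (s : SumO) : notT (olt (o := SumO) (existT _ top top) s).
Proof.
destruct s as [x a]; intros [h|[r h]]; simpl in *.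
- exact (top_max _ h).
- destruct r; exact (top_max _ h).
Qed.

Definition SumT : OrdT := MkOrdT SumO (existT _ top top) sum_top_max.

End Sum.

Definition addT (tau ups : OrdT) : OrdT :=
  SumT twoT (fun b => match b with inl _ => tau | inr _ => ups end).

Definition mulT (tau ups : OrdT) : OrdT := SumT tau (fun _ => ups).

(** *** Extension of a family along an embedding *)

Section Extension.

Variables (X K : Type) (j : X -> K) (j_emb : is_embedding j) (alpha : X -> OrdT).

Definition ext_carrier (k : K) : Type :=
  forall q : fiber j k, alpha (projT1 q).

Definition ext_lt (k : K) (u v : ext_carrier k) : Type :=
  {q : fiber j k & olt (u q) (v q)}.

Lemma ext_lt_prop k u v : is_prop (ext_lt k u v).
Proof. apply is_prop_sigT; [apply j_emb|intro; apply olt_prop]. Qed.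

Lemma ext_lt_trans k u v w : ext_lt k u v -> ext_lt k v w -> ext_lt k u w.
Proof.
intros [q h] [q' h']; exists q.
destruct (j_emb k q q'); exact (olt_trans _ _ _ h h').
Qed.

Lemma ext_lt_at_incl k (u v : ext_carrier k) (q : fiber j k) :
  (forall w, ext_lt k w u -> ext_lt k w v) ->
  forall a, olt a (u q) -> olt a (v q).
Proof.
intros f a h.
pose (w := fun q' => rew [fun p => carrier (alpha (projT1 p))] j_emb k q q' in a).
assert (e : w q = a).
{ unfold w; rewrite (prop_is_set (j_emb k) q q (j_emb k q q) eq_refl); reflexivity. }
destruct (f w) as [q' h'].
- exists q; rewrite e; exact h.
- destruct (j_emb k q q'); rewrite e in h'; exact h'.
Qed.

Lemma ext_lt_ext k u v :
  (forall w, ext_lt k w u -> ext_lt k w v) ->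
  (forall w, ext_lt k w v -> ext_lt k w u) -> u = v.
Proof.
intros f g; apply functional_extensionality_dep; intro q; apply olt_ext.
- exact (ext_lt_at_incl k u v q f).
- exact (ext_lt_at_incl k v u q g).
Qed.

Lemma ext_acc_at k (q : fiber j k) (a : alpha (projT1 q)) :
  forall u : ext_carrier k, u q = a -> acc (ext_lt k) u.
Proof.
induction (olt_wf a) as [a _ IH]; intros u e; constructor; intros v [q' h].
destruct (j_emb k q q'); rewrite e in h; exact (IH _ h v eq_refl).
Qed.

Lemma ext_lt_wf k u : acc (ext_lt k) u.
Proof.
constructor; intros v [q _]; exact (ext_acc_at k q (v q) v eq_refl).
Qed.

Definition ExtO (k : K) : Ord :=
  MkOrd (ext_carrier k) (ext_lt k)
    (ext_lt_prop k) (ext_lt_trans k) (ext_lt_ext k) (ext_lt_wf k).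

Definition ExtT (k : K) : OrdT :=
  MkOrdT (ExtO k) (fun _ => top) (fun _ h => top_max _ (projT2 h)).

Definition ev (x : X) (u : ExtT (j x)) : alpha x := u (existT _ x eq_refl).

Definition ev_inv (x : X) (a : alpha x) : ExtT (j x) :=
  fun q => eq_rect (existT _ x eq_refl) (fun p => carrier (alpha (projT1 p)))
             a q (j_emb (j x) (existT _ x eq_refl) q).

Lemma ev_ev_inv x (a : alpha x) : ev x (ev_inv x a) = a.
Proof.
unfold ev, ev_inv.
rewrite (prop_is_set (j_emb (j x)) _ _ (j_emb (j x) _ _) eq_refl); reflexivity.
Qed.

Lemma ev_inv_ev x (u : ExtT (j x)) : ev_inv x (ev x u) = u.
Proof.
apply functional_extensionality_dep; intro q; unfold ev, ev_inv.
destruct (j_emb (j x) (existT _ x eq_refl) q); reflexivity.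
Qed.

Lemma ev_preserving x : order_preserving (ev x).
Proof.
intros u v [q h].
exact (eq_rect q (fun p => olt (u p) (v p)) h _ (j_emb (j x) q (existT _ x eq_refl))).
Qed.

Lemma ev_inv_preserving x : order_preserving (ev_inv x).
Proof.
intros a b h; exists (existT (fun z => j z = j x) x eq_refl).
change (olt (ev x (ev_inv x a)) (ev x (ev_inv x b))).
rewrite !ev_ev_inv; exact h.
Qed.

End Extension.

Arguments ExtT {X K j} j_emb alpha k.
Arguments ev {X K j} j_emb alpha x u.
Arguments ev_inv {X K j} j_emb alpha x a.

(** ** Codes *)

(** Rocq has no induction-recursion.  [code tau] is the type of codes whose
    decoding is [tau], so that the inductive-recursive pair is its total space
    with the first projection.  The inductive-recursive constructors, the
    computation rules of [Delta] (all definitional) and the induction principle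
    are derived below. *)
Inductive code : OrdT -> Type :=
| code_one : code oneT
| code_omega1 : code omega1T
| code_add : forall tau ups, code tau -> code ups -> code (addT tau ups)
| code_mul : forall tau ups, code tau -> code ups -> code (mulT tau ups)
| code_sum : forall (tau : OrdT) (ups : tau -> OrdT),
    code tau -> (forall x, code (ups x)) -> code (SumT tau ups).

Definition E : Type := {tau : OrdT & code tau}.

Definition Delta (nu : E) : OrdT := projT1 nu.

Definition E_one : E := existT _ oneT code_one.

Definition E_omega1 : E := existT _ omega1T code_omega1.

Definition E_add (nu0 nu1 : E) : E :=
  existT _ (addT (Delta nu0) (Delta nu1)) (code_add _ _ (projT2 nu0) (projT2 nu1)).

Definition E_mul (nu0 nu1 : E) : E :=
  existT _ (mulT (Delta nu0) (Delta nu1)) (code_mul _ _ (projT2 nu0) (projT2 nu1)).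

Definition E_sum (nu : E) (A : Delta nu -> E) : E :=
  existT _ (SumT (Delta nu) (fun x => Delta (A x)))
    (code_sum _ (fun x => Delta (A x)) (projT2 nu) (fun x => projT2 (A x))).

Definition E_ind_rec (P : E -> Type)
    (P_one : P E_one)
    (P_omega1 : P E_omega1)
    (P_add : forall nu0 nu1, P nu0 -> P nu1 -> P (E_add nu0 nu1))
    (P_mul : forall nu0 nu1, P nu0 -> P nu1 -> P (E_mul nu0 nu1))
    (P_sum : forall nu (A : Delta nu -> E),
       P nu -> (forall x, P (A x)) -> P (E_sum nu A)) :
  forall nu : E, P nu :=
  let fix go tau (c : code tau) : P (existT _ tau c) :=
    match c in code tau return P (existT _ tau c) with
    | code_one => P_one
    | code_omega1 => P_omega1
    | code_add tau ups c d =>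
        P_add (existT _ tau c) (existT _ ups d) (go tau c) (go ups d)
    | code_mul tau ups c d =>
        P_mul (existT _ tau c) (existT _ ups d) (go tau c) (go ups d)
    | code_sum tau ups c d =>
        P_sum (existT _ tau c) (fun x => existT _ (ups x) (d x))
          (go tau c) (fun x => go (ups x) (d x))
    end
  in fun nu => match nu with existT _ tau c => go tau c end.

(** ** The ordinals K and the embeddings iota *)

Record emb_of (tau : OrdT) : Type := MkEmb {
  emb_cod : OrdT;
  emb_fun : tau -> emb_cod;
  emb_is_embedding : is_embedding emb_fun
}.

Arguments MkEmb {tau} emb_cod emb_fun.
Arguments emb_cod {tau} e.
Arguments emb_fun {tau} e x.
Arguments emb_is_embedding {tau} e.

Definition emb_one : emb_of oneT.
Proof.
refine (MkEmb oneT (fun x => x) _).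
apply injective_is_embedding; [apply ord_is_set|intros x x' e; exact e].
Defined.

Definition emb_omega1 : emb_of omega1T := MkEmb (tau := omega1T) conatT iota1 iota1_embedding.

Section EmbConstructions.

Variables (tau ups : OrdT) (e : emb_of tau) (f : emb_of ups).

Definition add_fun (s : addT tau ups) : addT (emb_cod e) (emb_cod f) :=
  match s with
  | existT _ (inl u) y => existT _ (inl u) (emb_fun e y)
  | existT _ (inr u) y => existT _ (inr u) (emb_fun f y)
  end.

Lemma add_fun_embedding : is_embedding add_fun.
Proof.
apply injective_is_embedding; [apply ord_is_set|].
intros [[[]|[]] y] [[[]|[]] z] h.
- apply (sigT_snd_inj _ _ _ _ (ord_is_set twoT)) in h.
  f_equal; exact (embedding_injective _ (emb_is_embedding e) _ _ h).
- discriminate (projT1_eq h).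
- discriminate (projT1_eq h).
- apply (sigT_snd_inj _ _ _ _ (ord_is_set twoT)) in h.
  f_equal; exact (embedding_injective _ (emb_is_embedding f) _ _ h).
Qed.

Definition emb_add : emb_of (addT tau ups) :=
  MkEmb (addT (emb_cod e) (emb_cod f)) add_fun add_fun_embedding.

Definition mul_fun (s : mulT tau ups) : mulT (emb_cod e) (emb_cod f) :=
  existT _ (emb_fun e (projT1 s)) (emb_fun f (projT2 s)).

Lemma mul_fun_embedding : is_embedding mul_fun.
Proof.
apply injective_is_embedding; [apply ord_is_set|].
intros [x y] [x' y'] h.
pose proof (embedding_injective _ (emb_is_embedding e) _ _ (projT1_eq h)) as r.
simpl in r; destruct r.
apply (sigT_snd_inj _ _ _ _ (ord_is_set (emb_cod e))) in h; simpl in h.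
f_equal; exact (embedding_injective _ (emb_is_embedding f) _ _ h).
Qed.

Definition emb_mul : emb_of (mulT tau ups) :=
  MkEmb (mulT (emb_cod e) (emb_cod f)) mul_fun mul_fun_embedding.

End EmbConstructions.

Section EmbSum.

Variables (tau : OrdT) (ups : tau -> OrdT).
Variables (e : emb_of tau) (f : forall x, emb_of (ups x)).

Definition sum_cod : OrdT :=
  SumT (emb_cod e) (ExtT (emb_is_embedding e) (fun x => emb_cod (f x))).

Definition sum_fun (s : SumT tau ups) : sum_cod :=
  existT _ (emb_fun e (projT1 s))
    (ev_inv (emb_is_embedding e) (fun x => emb_cod (f x)) (projT1 s)
       (emb_fun (f (projT1 s)) (projT2 s))).

Lemma sum_fun_embedding : is_embedding sum_fun.
Proof.
apply injective_is_embedding; [apply ord_is_set|].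
intros [x y] [x' y'] h.
pose proof (embedding_injective _ (emb_is_embedding e) _ _ (projT1_eq h)) as r.
simpl in r; destruct r.
apply (sigT_snd_inj _ _ _ _ (ord_is_set (emb_cod e))) in h; simpl in h.
apply (f_equal (ev (emb_is_embedding e) (fun x => emb_cod (f x)) x)) in h.
rewrite !ev_ev_inv in h.
f_equal; exact (embedding_injective _ (emb_is_embedding (f x)) _ _ h).
Qed.

Definition emb_sum : emb_of (SumT tau ups) :=
  MkEmb sum_cod sum_fun sum_fun_embedding.

End EmbSum.

Fixpoint emb_of_code {tau : OrdT} (c : code tau) : emb_of tau :=
  match c in code tau return emb_of tau with
  | code_one => emb_one
  | code_omega1 => emb_omega1
  | code_add tau ups c d => emb_add tau ups (emb_of_code c) (emb_of_code d)
  | code_mul tau ups c d => emb_mul tau ups (emb_of_code c) (emb_of_code d)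
  | code_sum tau ups c d =>
      emb_sum tau ups (emb_of_code c) (fun x => emb_of_code (d x))
  end.

Definition K (nu : E) : OrdT := emb_cod (emb_of_code (projT2 nu)).

Definition iota (nu : E) : Delta nu -> K nu := emb_fun (emb_of_code (projT2 nu)).

Definition iota_embedding (nu : E) : is_embedding (iota nu) :=
  emb_is_embedding (emb_of_code (projT2 nu)).

(** The defining equations of [K] and [iota], all definitional. *)

Fact K_one : K E_one = oneT.
Proof. reflexivity. Qed.

Fact K_omega1 : K E_omega1 = conatT.
Proof. reflexivity. Qed.

Fact K_add nu0 nu1 : K (E_add nu0 nu1) = addT (K nu0) (K nu1).
Proof. reflexivity. Qed.

Fact K_mul nu0 nu1 : K (E_mul nu0 nu1) = mulT (K nu0) (K nu1).
Proof. reflexivity. Qed.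

Fact K_sum nu (A : Delta nu -> E) :
  K (E_sum nu A) = SumT (K nu) (ExtT (iota_embedding nu) (fun x => K (A x))).
Proof. reflexivity. Qed.

Fact iota_one (x : Delta E_one) : iota E_one x = x.
Proof. reflexivity. Qed.

Fact iota_omega1 (x : Delta E_omega1) : iota E_omega1 x = iota1 x.
Proof. reflexivity. Qed.

Fact iota_add_inl nu0 nu1 (y : Delta nu0) :
  iota (E_add nu0 nu1) (existT _ (inl tt) y) = existT _ (inl tt) (iota nu0 y).
Proof. reflexivity. Qed.

Fact iota_add_inr nu0 nu1 (y : Delta nu1) :
  iota (E_add nu0 nu1) (existT _ (inr tt) y) = existT _ (inr tt) (iota nu1 y).
Proof. reflexivity. Qed.

Fact iota_mul nu0 nu1 (x : Delta nu0) (y : Delta nu1) :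
  iota (E_mul nu0 nu1) (existT _ x y) = existT _ (iota nu0 x) (iota nu1 y).
Proof. reflexivity. Qed.

Fact iota_sum nu (A : Delta nu -> E) (x : Delta nu) (z : Delta (A x)) :
  iota (E_sum nu A) (existT _ x z) =
  existT _ (iota nu x)
    (ev_inv (iota_embedding nu) (fun x => K (A x)) x (iota (A x) z)).
Proof. reflexivity. Qed.

(* Main.v *)
Require Import Defs.
From Stdlib Require Import Bool Arith FunctionalExtensionality.

(** Both parts follow by induction on codes, because infima of complemented
    subsets and extremely dense order embeddings are stable under the operations
    that build [K] and [iota].

    Infima.  In a lexicographic sum one minimizes in every fiber first and then
    minimizes over the base those points whose fiberwise infimum is a root
    ([sum_infima]).  The fibers of the sum attached to a code are the products
    [ExtT], indexed by a fiber of an embedding, that is, by a proposition.  Such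
    a product is equivalent to each of its factors as soon as the index type has
    a point, so the infimum can be chosen factor by factor; that it is a root
    whenever there is one is a decidable statement, hence can be proved by
    distinguishing whether the index type is inhabited, although this is
    undecidable ([ext_infima]).  In the conaturals the infimum of [p] is the
    binary sequence that stays at one until the first finite root of [p]; when
    there is no finite root it is infinity, and the extreme density of the
    finite points together with infinity shows that it is a root if anything is
    ([conat_infima]).  Compactness is then decided by the value of [p] at its
    infimum.

    Embeddings.  The maps between lexicographic sums that occur all have the form
    [(x, a) |-> (e x, h x a)].  Density, being negative, can be checked one
    coordinate at a time, and an embedding [e] identifies equalities
    [e x = e x'] with equalities [x = x'], so both the order and its reflection
    pass from [e] and [h] to the sum ([sum_map_dense_order]). *)

(** * Infima of complemented subsets *)

Definition has_infima (X : Ord) : Type :=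
  has_infima_of_complemented_subsets X (fun x y => ole x y).

Lemma infima_compact (X : Ord) : has_infima X -> compact X.
Proof.
intros H p; destruct (H p) as [x0 [hroot _]].
destruct (p x0) eqn:e.
- right; intro hx; pose proof (hroot hx) as h; unfold root in h.
  rewrite e in h; discriminate h.
- left; exists x0; exact e.
Qed.

Lemma one_infima : has_infima oneT.
Proof.
intro p; exists tt; split; [intros [[] h]; exact h|split].
- intros x _ [].
- intros l _ [].
Qed.

Lemma two_infima : has_infima twoT.
Proof.
intro p; destruct (p (inl tt)) eqn:e.
- exists (inr tt); split; [|split].
  + intros [[[]|[]] h]; [unfold root in h; rewrite e in h; discriminate h|exact h].
  + intros [[]|[]] h lt; [unfold root in h; rewrite e in h; discriminate h|destruct lt].
  + intros l _; exact (top_max (o := twoT) l).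
- exists (inl tt); split; [intros _; exact e|split].
  + intros x _ lt; destruct x; destruct lt.
  + intros l h; exact (h (inl tt) e).
Qed.

Lemma sum_infima (tau : OrdT) (ups : tau -> OrdT) :
  has_infima tau -> (forall x, has_infima (ups x)) -> has_infima (SumT tau ups).
Proof.
intros Ht Hu p.
pose (a := fun x => projT1 (Hu x (fun y => p (existT _ x y)))).
assert (Ha : forall x,
  ({y : ups x & p (existT _ x y) = false} -> p (existT _ x (a x)) = false) *
  ((forall y, p (existT _ x y) = false -> ole (a x) y) *
   (forall l, (forall y, p (existT _ x y) = false -> ole l y) -> ole l (a x)))).
{ intro x; exact (projT2 (Hu x (fun y => p (existT _ x y)))). }
destruct (Ht (fun x => p (existT _ x (a x)))) as [x0 [hroot [hlow hgreat]]].
unfold root in *.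
assert (Hbase : forall x y, p (existT _ x y) = false -> p (existT _ x (a x)) = false).
{ intros x y h; apply (fst (Ha x)); exists y; exact h. }
exists (existT _ x0 (a x0)); split; [|split].
- intros [[x y] h]; apply hroot; exists x; exact (Hbase x y h).
- intros [x y] h [lt|[r lt]]; simpl in *.
  + exact (hlow x (Hbase x y h) lt).
  + destruct r; exact (fst (snd (Ha x)) y h lt).
- intros [y b] h [lt|[r lt]]; simpl in *.
  + apply (hgreat y); [|exact lt].
    intros x hx lt'; exact (h (existT _ x (a x)) hx (inl lt')).
  + destruct r; apply (snd (snd (Ha x0)) b); [|exact lt].
    intros c hc lt'; apply (h (existT _ x0 c) hc).
    right; exists eq_refl; exact lt'.
Qed.

(** The value at [q] of the infimum is the infimum of [p] transported to the
    factor at [q] along evaluation at [q], an order equivalence because the index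
    type is a proposition. *)
Lemma ext_infima (X K : Type) (j : X -> K) (j_emb : is_embedding j)
    (alpha : X -> OrdT) (k : K) :
  (forall x, has_infima (alpha x)) -> has_infima (ExtT j_emb alpha k).
Proof.
intros H p.
(* [inj q] is the inverse of evaluation at [q]. *)
pose (inj := fun (q : fiber j k) (y : alpha (projT1 q)) =>
  (fun q' => eq_rect q (fun z => carrier (alpha (projT1 z))) y q' (j_emb k q q'))
  : ExtT j_emb alpha k).
assert (inj_at : forall q y, inj q y q = y).
{ intros q y; unfold inj.
  rewrite (prop_is_set (j_emb k) q q (j_emb k q q) eq_refl); reflexivity. }
assert (inj_ev : forall q (u : ExtT j_emb alpha k), inj q (u q) = u).
{ intros q u; apply functional_extensionality_dep; intro q'; unfold inj.
  destruct (j_emb k q q'); reflexivity. }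
pose (u0 := (fun q => projT1 (H (projT1 q) (fun y => p (inj q y))))
  : ExtT j_emb alpha k).
assert (Hu : forall q,
  ({y : alpha (projT1 q) & p (inj q y) = false} -> p (inj q (u0 q)) = false) *
  ((forall y, p (inj q y) = false -> ole (u0 q) y) *
   (forall l, (forall y, p (inj q y) = false -> ole l y) -> ole l (u0 q)))).
{ intro q; exact (projT2 (H (projT1 q) (fun y => p (inj q y)))). }
exists u0; unfold root; split; [|split].
- intros [v hv]; destruct (p u0) eqn:e; [exfalso|reflexivity].
  (* A point of the index type would make [u0] a root; without points, the
     product has only one element. *)
  assert (empty : fiber j k -> False).
  { intro q; rewrite <- (inj_ev q u0), (fst (Hu q)) in e; [discriminate e|].
    exists (v q); rewrite inj_ev; exact hv. }
  assert (e' : u0 = v).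
  { apply functional_extensionality_dep; intro q; destruct (empty q). }
  rewrite e', hv in e; discriminate e.
- intros v hv [q lt].
  apply (fst (snd (Hu q)) (v q)); [rewrite inj_ev; exact hv|exact lt].
- intros l hl [q lt].
  apply (snd (snd (Hu q)) (l q)); [|exact lt].
  intros y hy lt'; apply (hl (inj q y) hy).
  exists q; rewrite inj_at; exact lt'.
Qed.

(** * Conatural numbers *)

Lemma under_of_digit_false (u : conat) (n : nat) :
  digit u n = false -> {m : nat & u = under m}.
Proof.
induction n as [|n IH]; intro e.
- exists 0; apply conat_eq; intro i; rewrite digit_under.
  destruct (digit u i) eqn:d; [|reflexivity].
  rewrite (digit_down u 0 i (Nat.le_0_l i) d) in e; discriminate e.
- destruct (digit u n) eqn:d; [|exact (IH eq_refl)].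
  exists (S n); apply conat_eq; intro i; rewrite digit_under.
  destruct (Nat.ltb_spec i (S n)) as [h|h].
  + exact (digit_down u i n (proj1 (Nat.lt_succ_r i n) h) d).
  + destruct (digit u i) eqn:d'; [|reflexivity].
    rewrite (digit_down u (S n) i h d') in e; discriminate e.
Qed.

Lemma iota1_dense : extremely_dense iota1.
Proof.
intros [u h].
assert (e : u = infty).
{ apply conat_eq; intro i; destruct (digit u i) eqn:d; [reflexivity|exfalso].
  destruct (under_of_digit_false u i d) as [m r].
  destruct h; exists (inl m); exact (eq_sym r). }
destruct h; exists (inr tt); exact (eq_sym e).
Qed.

Lemma iota1_preserving : order_preserving (X := omega1T) (Y := conatT) iota1.
Proof.
intros [m|[]] [n|[]] h; simpl in h; try destruct h; exists m; (split; [reflexivity|]).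
- apply Nat.ltb_lt; exact h.
- reflexivity.
Qed.

Lemma iota1_reflecting : order_reflecting (X := omega1T) (Y := conatT) iota1.
Proof.
intros [m|[]] y [k [e d]]; simpl in e.
- apply under_inj in e; destruct e; destruct y as [n|[]]; [|exact tt].
  apply Nat.ltb_lt; exact d.
- destruct (infty_not_under k e).
Qed.

Fixpoint no_root_upto (p : conat -> bool) (n : nat) : bool :=
  match n with
  | 0 => p (under 0)
  | S n => no_root_upto p n && p (under (S n))
  end.

Lemma no_root_upto_true (p : conat -> bool) (n : nat) :
  no_root_upto p n = true -> p (under n) = true.
Proof.
destruct n as [|n]; simpl; [exact (fun e => e)|].
intro e; apply andb_true_iff in e; exact (proj2 e).
Qed.

Lemma no_root_upto_false (p : conat -> bool) (n : nat) :
  no_root_upto p n = false -> {j : nat & ((j <= n) * (p (under j) = false))%type}.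
Proof.
induction n as [|n IH]; simpl; intro e.
- exists 0; split; [apply le_n|exact e].
- destruct (no_root_upto p n).
  + exists (S n); split; [apply le_n|exact e].
  + destruct (IH eq_refl) as [j [h r]]; exists j; split; [apply le_S; exact h|exact r].
Qed.

Definition first_root (p : conat -> bool) : conat.
Proof.
exists (no_root_upto p); intro i; simpl.
destruct (no_root_upto p i); simpl; [|exact I].
destruct (p (under (S i))); simpl; [reflexivity|exact I].
Defined.

(** With a finite root, [first_root p] would be the least one, and so a root. *)
Lemma first_root_no_finite_root (p : conat -> bool) :
  p (first_root p) = true -> forall n, p (under n) = true.
Proof.
intros e n; destruct (p (under n)) eqn:r; [reflexivity|exfalso].
assert (below : forall i, p (under i) = false -> digit (first_root p) i = false).
{ intros i ri; destruct (digit (first_root p) i) eqn:d; [|reflexivity].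
  apply no_root_upto_true in d; rewrite ri in d; discriminate d. }
destruct (under_of_digit_false _ _ (below n r)) as [m em].
assert (d : digit (first_root p) m = false) by (rewrite em; apply Nat.ltb_irrefl).
destruct (no_root_upto_false p m d) as [i [le ri]].
(* [m] is the length of [first_root p], so no [i < m] is a root. *)
apply below in ri as di; rewrite em, digit_under in di; apply Nat.ltb_ge in di.
rewrite (Nat.le_antisymm i m le di), <- em, e in ri; discriminate ri.
Qed.

Lemma conat_infima : has_infima conatT.
Proof.
intro p; exists (first_root p); unfold root; split; [|split].
- intros [x hx]; destruct (p (first_root p)) eqn:e; [exfalso|reflexivity].
  pose proof (first_root_no_finite_root p e) as fin.
  assert (einf : first_root p = infty).
  { apply conat_eq; intro i.
    destruct (digit (first_root p) i) eqn:d; [reflexivity|exfalso].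
    destruct (no_root_upto_false p i d) as [k [_ r]].
    rewrite fin in r; discriminate r. }
  (* [p] is one on the image of [iota1], so the root [x] lies outside it. *)
  refine (match iota1_dense _ with end).
  exists x; intros [[n|[]] ex]; exfalso; simpl in ex; rewrite <- ex in hx.
  + rewrite fin in hx; discriminate hx.
  + rewrite <- einf, e in hx; discriminate hx.
- intros x hx [n [ex d]]; exfalso.
  apply no_root_upto_true in d; rewrite <- ex, hx in d; discriminate d.
- intros l hl [n [eu d]].
  assert (dn : digit (first_root p) n = false) by (rewrite eu; apply Nat.ltb_irrefl).
  destruct (no_root_upto_false p n dn) as [i [le r]].
  apply (hl (under i) r); exists i; split; [reflexivity|].
  exact (digit_down l i n le d).
Qed.

(** * Extremely dense order embeddings *)

Definition dense_order {X Y : Ord} (f : X -> Y) : Type :=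
  (extremely_dense f * order_preserving f * order_reflecting f)%type.

Lemma extremely_dense_fiber {X Y : Type} (f : X -> Y) :
  extremely_dense f -> forall y, notT (notT (fiber f y)).
Proof. intros H y h; apply H; exists y; exact h. Qed.

(** The map [g] is only required to agree with [(x, a) |-> (e x, h x a)] up to
    equality at each pair, since [add_fun] computes only once the summand is
    known. *)
Lemma sum_map_dense_order (tau tau' : OrdT) (ups : tau -> OrdT) (ups' : tau' -> OrdT)
    (e : tau -> tau') (h : forall x, ups x -> ups' (e x))
    (g : SumT tau ups -> SumT tau' ups') :
  is_embedding e -> dense_order e -> (forall x, dense_order (h x)) ->
  (forall x a, g (existT _ x a) = existT _ (e x) (h x a)) ->
  dense_order g.
Proof.
intros emb [[ed ep] er] hh eg; split; [split|].
- intros [[k b] n].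
  refine (match extremely_dense_fiber e ed k _ with end); intros [x r]; destruct r.
  refine (match extremely_dense_fiber (h x) (fst (fst (hh x))) b _ with end).
  intros [a r]; destruct r; apply n; exists (existT _ x a); apply eg.
- intros [x a] [x' a'] lt; rewrite !eg; destruct lt as [lt|[r lt]]; simpl in *.
  + left; exact (ep _ _ lt).
  + destruct r; right; exists eq_refl; exact (snd (fst (hh x)) _ _ lt).
- intros [x a] [x' a'] lt; rewrite !eg in lt; destruct lt as [lt|[r lt]]; simpl in *.
  + left; exact (er _ _ lt).
  + pose proof (embedding_injective e emb x x' r) as r'; destruct r'.
    rewrite (ord_is_set tau' _ _ r eq_refl) in lt.
    right; exists eq_refl; exact (snd (hh x) _ _ lt).
Qed.

Lemma id_dense_order (X : Ord) : dense_order (fun x : X => x).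
Proof.
split; [split|]; [|exact (fun _ _ lt => lt)|exact (fun _ _ lt => lt)].
intros [y h]; apply h; exists y; reflexivity.
Qed.

Lemma id_embedding (X : Ord) : is_embedding (fun x : X => x).
Proof.
apply injective_is_embedding; [apply ord_is_set|exact (fun _ _ r => r)].
Qed.

(** Since [ev_inv] is an order equivalence, composing with it preserves all three
    properties. *)
Lemma ev_inv_dense_order (X K : Type) (j : X -> K) (j_emb : is_embedding j)
    (alpha : X -> OrdT) (x : X) (Y : Ord) (f : Y -> alpha x) :
  dense_order f ->
  dense_order (Y := ExtT j_emb alpha (j x)) (fun y => ev_inv j_emb alpha x (f y)).
Proof.
intros [[d p] r]; split; [split|].
- intros [u n].
  refine (match extremely_dense_fiber f d (ev j_emb alpha x u) _ with end).
  intros [y e]; apply n; exists y; rewrite e; apply ev_inv_ev.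
- intros y y' lt; apply (ev_inv_preserving X K j j_emb alpha x); exact (p _ _ lt).
- intros y y' lt; apply r.
  apply (ev_preserving X K j j_emb alpha x) in lt; rewrite !ev_ev_inv in lt.
  exact lt.
Qed.

(** * Induction on codes *)

Lemma K_infima (nu : E) : has_infima (K nu).
Proof.
induction nu as [| |nu0 nu1 H0 H1|nu0 nu1 H0 H1|nu A H HA] using E_ind_rec.
- exact one_infima.
- exact conat_infima.
- apply sum_infima; [exact two_infima|intros [x|x]; assumption].
- apply sum_infima; [exact H0|intros _; exact H1].
- apply sum_infima; [exact H|intro k; apply ext_infima; exact HA].
Qed.

Lemma iota_dense_order (nu : E) : dense_order (iota nu).
Proof.
induction nu as [| |nu0 nu1 H0 H1|nu0 nu1 H0 H1|nu A H HA] using E_ind_rec.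
- exact (id_dense_order oneT).
- exact (iota1_dense, iota1_preserving, iota1_reflecting).
- apply (sum_map_dense_order twoT twoT
    (fun b => match b with inl _ => Delta nu0 | inr _ => Delta nu1 end)
    (fun b => match b with inl _ => K nu0 | inr _ => K nu1 end)
    (fun b => b)
    (fun b => match b with inl _ => iota nu0 | inr _ => iota nu1 end)).
  + apply id_embedding.
  + apply id_dense_order.
  + intros [x|x]; assumption.
  + intros [x|x] a; reflexivity.
- apply (sum_map_dense_order (Delta nu0) (K nu0) _ _ (iota nu0) (fun _ => iota nu1)).
  + apply iota_embedding.
  + exact H0.
  + intros _; exact H1.
  + reflexivity.
- apply (sum_map_dense_order (Delta nu) (K nu) _ _ (iota nu)
    (fun x z => ev_inv (iota_embedding nu) (fun x => K (A x)) x (iota (A x) z))).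
  + apply iota_embedding.
  + exact H.
  + intro x; apply ev_inv_dense_order; exact (HA x).
  + reflexivity.
Qed.

Theorem theorem7p5 (nu : E) :
  (has_infima_of_complemented_subsets (K nu) (fun x y => ole x y) *
   compact (K nu)) *
  (extremely_dense (iota nu) *
   order_preserving (iota nu) *
   order_reflecting (iota nu)).
Proof.
exact ((K_infima nu, infima_compact _ (K_infima nu)), iota_dense_order nu).
Qed.
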